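(* Let $P:X\to[0,\infty)$ be a seminorm on an extended locally convex space $(X,\tau)$ and let $\tau_F$ be the flc topology for $(X,\tau)$. Then $P$ is lower semi-continuous with respect to $\tau$ if and only if $P$ is lower semi-continuous with respect to $\tau_F$.
   Context: Vector spaces are over $\mathbb{K}\in\{\mathbb{R},\mathbb{C}\}$. An extended seminorm on a vector space $X$ is a map $\rho:X\to[0,\infty]$ with $\rho(\alpha x)=|\alpha|\rho(x)$ (convention $0\cdot\infty=0$) and $\rho(x+y)\le\rho(x)+\rho(y)$; a seminorm is one taking only finite values. An extended locally convex space (elcs) is a vector space $X$ with a Hausdorff topology $\tau$ induced by a family $\mathcal{P}$ of extended seminorms, i.e. the sets $\{y\in X:\rho(y-x)<\epsilon\}$ ($\rho\in\mathcal{P}$, $x\in X$, $\epsilon>0$) form a subbase of $\tau$. The flc topology $\tau_F$ for an elcs $(X,\tau)$ is the finest locally convex topology (topology induced by a family of finite-valued seminorms) on $X$ that is coarser than $\tau$. A function $f:X\to\mathbb{R}$ on a topological space is lower semi-continuous if $f^{-1}((c,\infty))$ is open for every $c\in\mathbb{R}$. *)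

(* Defs.v *)
From HB Require Import structures.
From mathcomp Require Import all_boot all_order all_algebra.
From mathcomp Require Import complex.
From mathcomp Require Import all_classical all_reals all_analysis.

Set Implicit Arguments.
Unset Strict Implicit.
Unset Printing Implicit Defensive.

Import Order.TTheory GRing.Theory Num.Theory.
Import numFieldNormedType.Exports.

Local Open Scope classical_set_scope.
Local Open Scope ring_scope.

Inductive scalar_kind := RealScalars | ComplexScalars.

Definition scalars (R : realType) (k : scalar_kind) : numFieldType :=
  match k with
  | RealScalars => R
  | ComplexScalars => R[i]%C
  end.

(* The norm of [R[i]] takes its values in [R[i]] (with zero imaginary part);
   [modulus] is the [R]-valued one. *)
Definition modulus (R : realType) (k : scalar_kind) : scalars R k -> R :=
  match k return scalars R k -> R with
  | RealScalars => fun a => `|a|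
  | ComplexScalars => fun a => complex.Re `|a|
  end.

(* In [\bar R], [0 * +oo = 0]. *)
Definition extended_seminorm (R : realType) (k : scalar_kind)
    (X : lmodType (scalars R k)) (rho : X -> \bar R) : Prop :=
  [/\ forall x, (0 <= rho x)%E,
      forall (a : scalars R k) (x : X),
        rho (a *: x) = ((modulus a)%:E * rho x)%E
    & forall x y, (rho (x + y)%R <= rho x + rho y)%E].

Definition seminorm (R : realType) (k : scalar_kind)
    (X : lmodType (scalars R k)) (p : X -> R) : Prop :=
  extended_seminorm (EFin \o p).

(* Several topologies live on the same vector space [X], so a topology on [X]
   is an inhabitant of the structure record [Topological X], and [X] equipped
   with it is [Topological.Pack tau : topologicalType]. *)
Definition space (X : Type) (tau : Topological X) : topologicalType :=
  Topological.Pack tau.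

Definition coarser (X : Type) (sigma tau : Topological X) : Prop :=
  forall U : set X, @open (space sigma) U -> @open (space tau) U.

Definition subbase (X : Type) (tau : Topological X) (S : set (set X)) : Prop :=
  @basis (space tau) (finI_from S id).

Definition seminorm_balls (R : realType) (k : scalar_kind)
    (X : lmodType (scalars R k)) (Ps : set (X -> \bar R)) : set (set X) :=
  [set B | exists rho (x : X) (e : R),
    [/\ Ps rho, 0 < e & B = [set y | (rho (y - x)%R < e%:E)%E]]].

Definition induced_by (R : realType) (k : scalar_kind)
    (X : lmodType (scalars R k)) (tau : Topological X)
    (Ps : set (X -> \bar R)) : Prop :=
  subbase tau (seminorm_balls Ps).

Definition elcs (R : realType) (k : scalar_kind)
    (X : lmodType (scalars R k)) (tau : Topological X) : Prop :=
  hausdorff_space (space tau) /\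
  exists Ps : set (X -> \bar R),
    (forall rho, Ps rho -> extended_seminorm rho) /\ induced_by tau Ps.

(* No separation is required here, unlike in [elcs]. *)
Definition locally_convex (R : realType) (k : scalar_kind)
    (X : lmodType (scalars R k)) (tau : Topological X) : Prop :=
  exists Ps : set (X -> R),
    (forall p, Ps p -> seminorm p) /\
    induced_by tau [set EFin \o p | p in Ps].

Definition flc_topology (R : realType) (k : scalar_kind)
    (X : lmodType (scalars R k)) (tau tauF : Topological X) : Prop :=
  [/\ locally_convex tauF, coarser tauF tau
    & forall sigma : Topological X,
        locally_convex sigma -> coarser sigma tau -> coarser sigma tauF].

Definition lsc (R : realType) (X : Type) (tau : Topological X)
    (f : X -> R) : Prop :=
  @lower_semicontinuous (space tau) R (EFin \o f).

Lemma lscP (R : realType) (X : Type) (tau : Topological X) (f : X -> R) :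
  lsc tau f <-> forall c : R, @open (space tau) (f @^-1` `]c, +oo[).
Proof.
have fE (c : R) : [set x | ((EFin \o f) x > c%:E)%E] = f @^-1` `]c, +oo[.
  by apply/seteqP; split => x /=; rewrite lte_fin in_itv/= andbT.
by split=> [/lower_semicontinuousP h c|h];
  [rewrite -fE|apply/lower_semicontinuousP => c; rewrite fE].
Qed.

Definition generated (X : choiceType) (S : set (set X)) : Type := X.
HB.instance Definition _ (X : choiceType) (S : set (set X)) :=
  Choice.on (generated S).
HB.instance Definition _ (X : choiceType) (S : set (set X)) :=
  isSubBaseTopological.Build (generated S) S id.

Definition generated_topology (X : choiceType) (S : set (set X)) :
  Topological X := Topological.class (generated S).

Lemma subbase_generated (X : choiceType) (S : set (set X)) :
  subbase (generated_topology S) S.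
Proof.
split=> [A SA|x A].
  by exists [set A]; [move=> _ ->|rewrite bigcup_set1].
change (@nbhs _ (space (generated_topology S)) x A -> filter_from
  [set U | finI_from S id U /\ U x] id A).
rewrite nbhsE => -[B [[D DS <-] [C DC Cx]] sBA].
exists C; first by split=> //; exact: DS.
by move=> y Cy; apply: sBA; exists C.
Qed.

Lemma subbase_open (X : Type) (tau : Topological X) (S : set (set X)) :
  subbase tau S -> S `<=` @open (space tau).
Proof. by move=> [So _] A SA; apply: So; exact: (@finI_from1 _ _ S id A). Qed.

Lemma subbase_coarser (X : Type) (sigma tau : Topological X)
    (S : set (set X)) :
  subbase sigma S -> S `<=` @open (space tau) -> coarser sigma tau.
Proof.
move=> [_ Sb] So U Uo; rewrite (@openE (space tau)) => x Ux.
have /Sb [V [[D DS <-] Vx] VU] : @nbhs _ (space sigma) x U.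
  by apply: (@open_nbhs_nbhs (space sigma)).
rewrite /interior; apply: (@filterS _ (@nbhs _ (space tau) x) _ _ _ VU).
apply: filter_bigI => B DB; apply: (@open_nbhs_nbhs (space tau)).
by split; [apply: So; rewrite -inE; exact: DS|exact: Vx].
Qed.

Lemma flc_topology_exists (R : realType) (k : scalar_kind)
    (X : lmodType (scalars R k)) (tau : Topological X) :
  exists tauF : Topological X, flc_topology tau tauF.
Proof.
pose Q := [set p : X -> R | seminorm p /\
  seminorm_balls [set EFin \o p] `<=` @open (space tau)].
pose S := seminorm_balls [set EFin \o p | p in Q].
have Sg : subbase (generated_topology S) S by exact: subbase_generated.
exists (generated_topology S); split.
- by exists Q; split=> // p [].
- apply: subbase_coarser Sg _ => _ [_ [x [e [[p [_ +] <-] e0 ->]]]].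
  by apply; exists (EFin \o p), x, e.
- move=> sigma [P [Pn Ps]] st; apply: subbase_coarser (Ps) _.
  move=> _ [_ [x [e [[p Pp <-] e0 ->]]]]; apply: (subbase_open Sg).
  exists (EFin \o p), x, e; split=> //; exists p => //; split; first exact: Pn.
  move=> _ [_ [y [d [-> d0 ->]]]]; apply: st; apply: (subbase_open Ps).
  by exists (EFin \o p), y, d; split=> //; exists p.
Qed.

(* Main.v *)
(** Only the passage from [tau] to [tauF] needs work. If [c < c' < P x0], lower
    semi-continuity gives a [tau]-continuous extended seminorm [rho] such that
    [P > c'] on [{y | rho (y - x0) < r}], with [r >= c']. The infimal
    convolution [q x = inf_y (rho (x - y) + P y)] is an extended seminorm with
    [q <= P], hence finite, and [q <= rho], hence [tau]-continuous and so
    [tauF]-continuous. Moreover [q x0 >= c'], as either [rho (x0 - y) >= r] or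
    [P y > c']. Thus [P >= q > c] on the [tauF]-neighbourhood
    [{y | q (y - x0) < c' - c}] of [x0]. *)

Require Import Defs.
From HB Require Import structures.
From mathcomp Require Import all_boot all_order all_algebra.
From mathcomp Require Import complex.
From mathcomp Require Import all_classical all_reals all_analysis.
From mathcomp Require Import lra.

Set Implicit Arguments.
Unset Strict Implicit.
Unset Printing Implicit Defensive.

Import Order.TTheory GRing.Theory Num.Theory.
Import numFieldNormedType.Exports.

Local Open Scope classical_set_scope.
Local Open Scope ring_scope.

(** * Moduli of real and complex scalars *)

Lemma modulus_gt0 (R : realType) (k : scalar_kind) (a : scalars R k) :
  a != 0 -> 0 < modulus a.
Proof.
case: k a => /= a a0; first by rewrite normr_gt0.
by have : 0 < `|a| by [rewrite normr_gt0]; rewrite ltcE => /andP[].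
Qed.

Lemma modulus0 (R : realType) (k : scalar_kind) :
  modulus (0 : scalars R k) = 0.
Proof.
case: k; first exact: normr0.
exact: (congr1 (@complex.Re R) (normr0 R[i]%C)).
Qed.

Lemma modulus_ge0 (R : realType) (k : scalar_kind) (a : scalars R k) :
  0 <= modulus a.
Proof.
have [->|/modulus_gt0/ltW//] := eqVneq a 0.
by rewrite modulus0.
Qed.

Lemma modulusV (R : realType) (k : scalar_kind) (a : scalars R k) :
  modulus a^-1 = (modulus a)^-1.
Proof.
case: k a => [|] a; first exact: normfV.
(* The complex norm is real, hence the image of its real part under the embedding of [R], a field
   morphism that commutes with inversion. *)
have n_real : (complex.Re (`|a| : R[i]%C))%:C%C = `|a|.
  by apply: RRe_real; exact: normr_real.
rewrite /modulus (normfV (a : R[i]%C)) -[in LHS]n_real.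
by rewrite -(fmorphV (real_complex R)).
Qed.

Lemma modulusN1 (R : realType) (k : scalar_kind) :
  modulus (-1 : scalars R k) = 1.
Proof.
case: k; first exact: normrN1.
exact: (congr1 (@complex.Re R) (normrN1 R[i]%C)).
Qed.

(** * Operations on extended seminorms, up to infimal convolution *)

Section ExtendedSeminorms.
Context (R : realType) (k : scalar_kind) (X : lmodType (scalars R k)).
Implicit Types (rho : X -> \bar R) (x y : X).

Lemma extended_seminorm0 rho : extended_seminorm rho -> rho 0 = 0%E.
Proof. by move=> [_ h _]; rewrite -(scale0r 0) h modulus0 mul0e. Qed.

Lemma extended_seminormN rho x : extended_seminorm rho -> rho (- x) = rho x.
Proof. by move=> [_ h _]; rewrite -scaleN1r h modulusN1 mul1e. Qed.

Lemma extended_seminorm_cst0 : extended_seminorm (fun _ : X => 0%E : \bar R).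
Proof. by split=> // [a x|x y]; rewrite ?mule0 ?adde0. Qed.

Lemma extended_seminormZ rho (c : R) : 0 < c -> extended_seminorm rho ->
  extended_seminorm (fun x => c%:E * rho x)%E.
Proof.
move=> c0 [h0 hZ hD]; split=> [x|a x|x y].
- by rewrite mule_ge0 // lee_fin ltW.
- by rewrite hZ muleCA.
- by rewrite -ge0_muleDr // lee_pmul2l // lte_fin.
Qed.

Lemma extended_seminorm_max rho1 rho2 : extended_seminorm rho1 ->
  extended_seminorm rho2 ->
  extended_seminorm (fun x => maxe (rho1 x) (rho2 x)).
Proof.
move=> [p0 pZ pD] [q0 qZ qD]; split=> [x|a x|x y].
- by rewrite le_max p0.
- by rewrite pZ qZ maxe_pMr // ?lee_fin modulus_ge0.
- by rewrite ge_max (le_trans (pD _ _)) ?(le_trans (qD _ _)) //;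
    apply: leeD; rewrite le_max lexx ?orbT.
Qed.

(* It suffices to check one inequality for homogeneity, as [a] can be
   inverted. *)
Lemma extended_seminorm_subhomogeneous rho :
  (forall x, (0 <= rho x)%E) -> rho 0 = 0%E ->
  (forall a x, a != 0 -> (rho (a *: x)%R <= (modulus a)%:E * rho x)%E) ->
  (forall x y, (rho (x + y)%R <= rho x + rho y)%E) ->
  extended_seminorm rho.
Proof.
move=> h0 h00 hZ hD; split=> // a x.
have [->|a0] := eqVneq a 0; first by rewrite scale0r modulus0 mul0e.
apply/eqP; rewrite eq_le hZ //=.
rewrite -lee_pdivlMl ?modulus_gt0 // -modulusV.
by rewrite -[in leLHS](scalerK a0 x) hZ // invr_eq0.
Qed.

Definition inf_convolution rho1 rho2 x : \bar R :=
  ereal_inf [set (rho1 (x - y)%R + rho2 y)%E | y in [set: X]].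

Lemma inf_convolution_le rho1 rho2 x y :
  (inf_convolution rho1 rho2 x <= rho1 (x - y)%R + rho2 y)%E.
Proof. by apply: ereal_inf_lbound; exists y. Qed.

Lemma inf_convolution_lel rho1 rho2 x : extended_seminorm rho2 ->
  (inf_convolution rho1 rho2 x <= rho1 x)%E.
Proof.
move=> h; apply: le_trans (inf_convolution_le _ _ x 0) _.
by rewrite subr0 extended_seminorm0 // adde0.
Qed.

Lemma inf_convolution_ler rho1 rho2 x : extended_seminorm rho1 ->
  (inf_convolution rho1 rho2 x <= rho2 x)%E.
Proof.
move=> h; apply: le_trans (inf_convolution_le _ _ x x) _.
by rewrite subrr extended_seminorm0 // add0e.
Qed.

Lemma le_inf_convolution rho1 rho2 x (z : \bar R) :
  (forall y, (z <= rho1 (x - y)%R + rho2 y)%E) ->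
  (z <= inf_convolution rho1 rho2 x)%E.
Proof. by move=> h; apply: le_ereal_inf_tmp => _ [y _ <-]. Qed.

Lemma extended_seminorm_inf_convolution rho1 rho2 :
  extended_seminorm rho1 -> extended_seminorm rho2 ->
  extended_seminorm (inf_convolution rho1 rho2).
Proof.
move=> h1 h2; have [p0 pZ pD] := h1; have [q0 qZ qD] := h2.
have i0 x : (0 <= inf_convolution rho1 rho2 x)%E.
  by apply: le_inf_convolution => y; rewrite adde_ge0.
apply: extended_seminorm_subhomogeneous => //.
- apply/eqP; rewrite eq_le i0 andbT.
  by rewrite (le_trans (inf_convolution_lel _ _ h2)) // extended_seminorm0.
(* Splitting [x] at [y] amounts to splitting [a *: x] at [a *: y], which multiplies the sum by
   [modulus a]. *)
- move=> a x a0; rewrite -lee_pdivrMl ?modulus_gt0 //.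
  apply: le_inf_convolution => y; rewrite lee_pdivrMl ?modulus_gt0 //.
  by rewrite ge0_muleDr // -pZ -qZ scalerBr inf_convolution_le.
(* A splitting of [x] at [v] and one of [y] at [u] add up to a splitting of [x + y] at [v + u].
   Passing to the infimum in each variable moves the other term across the inequality, so that term
   must be finite; if it is infinite, the right-hand side is [+oo]. *)
- move=> x y; have [fy|] := boolP (inf_convolution rho1 rho2 y \is a fin_num).
    rewrite -leeBlDr //; apply: le_inf_convolution => u; rewrite leeBlDr //.
    have [fu|] := boolP ((rho1 (x - u)%R + rho2 u)%E \is a fin_num).
      rewrite addeC -leeBlDr //; apply: le_inf_convolution => v.
      rewrite leeBlDr //; apply: le_trans (inf_convolution_le _ _ _ (v + u)) _.
      rewrite addeACA (addrC x) opprD addrACA.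
      by apply: leeD; [exact: pD|exact: qD].
    rewrite ge0_fin_numE ?adde_ge0 // -leNgt leye_eq => /eqP ->.
    by rewrite addye ?leey // gt_eqF // (lt_le_trans _ (i0 y)) // ltNy0.
  rewrite ge0_fin_numE // -leNgt leye_eq => /eqP ->.
  by rewrite addey ?leey // gt_eqF // (lt_le_trans _ (i0 x)) // ltNy0.
Qed.

End ExtendedSeminorms.

(** * Continuous extended seminorms and neighbourhoods *)

Section ContinuousSeminorms.
Context (R : realType) (k : scalar_kind) (X : lmodType (scalars R k)).
Implicit Types (rho : X -> \bar R) (x y : X) (tau : Topological X).

(** The condition is imposed at every centre, as [tau] is an arbitrary topology, not known to be
    translation-invariant. *)
Definition continuous_extended_seminorm tau rho :=
  extended_seminorm rho /\ forall x (e : R), 0 < e ->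
    @nbhs _ (Defs.space tau) x [set y | (rho (y - x)%R < e%:E)%E].

Lemma open_seminorm_ball tau rho x (e : R) :
  continuous_extended_seminorm tau rho ->
  @open (Defs.space tau) [set y | (rho (y - x)%R < e%:E)%E].
Proof.
move=> [h hn]; have [h0 _ hD] := h.
rewrite (@openE (Defs.space tau)) => y /= yx.
have yfin : rho (y - x) \is a fin_num.
  by rewrite ge0_fin_numE // (lt_trans yx) ?ltry.
move: yx; rewrite -(fineK yfin) lte_fin -subr_gt0 => /(hn y).
apply: (@filterS _ (@nbhs _ (Defs.space tau) y)) => z /=.
rewrite EFinB lteBrDr // fineK // => /(le_lt_trans _); apply.
by rewrite (le_trans _ (hD _ _)) // addrA subrK.
Qed.

(** The topology generated by the balls of [q] alone is locally convex and coarser than [tau], hence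
    coarser than [tauF] by maximality. *)
Lemma flc_continuous_seminorm tau tauF (q : X -> R) :
  flc_topology tau tauF -> continuous_extended_seminorm tau (EFin \o q) ->
  continuous_extended_seminorm tauF (EFin \o q).
Proof.
move=> [_ _ finest] qc; have [qs _] := qc; split=> // x e e0.
pose S := seminorm_balls [set EFin \o q].
have Sg : subbase (generated_topology S) S by exact: subbase_generated.
have sF : coarser (generated_topology S) tauF.
  apply: finest.
    by exists [set q]; split=> [p ->//|]; rewrite image_set1.
  apply: subbase_coarser Sg _ => _ [_ [y [d [-> d0 ->]]]].
  exact: open_seminorm_ball.
apply: (@open_nbhs_nbhs (Defs.space tauF)); split.
  by apply/sF/(subbase_open Sg); exists (EFin \o q), x, e.
by have /= q0 := extended_seminorm0 qs; rewrite /= subrr q0 lte_fin.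
Qed.

(** A single seminorm is enough because finite intersections are absorbed by maxima, and the radius
    can be prescribed because seminorms can be rescaled. *)
Lemma elcs_nbhs_seminorm tau x (r : R) (V : set X) : 0 < r -> elcs tau ->
  @nbhs _ (Defs.space tau) x V ->
  exists2 rho, continuous_extended_seminorm tau rho &
    [set y | (rho (y - x)%R < r%:E)%E] `<=` V.
Proof.
move=> r0 [_ [Ps [Pn Pi]]].
(* Once the sets with the desired property are known to form a filter, only subbasic sets containing
   [x] remain to be checked. *)
pose N : set_system X := [set W | exists2 rho,
  continuous_extended_seminorm tau rho &
    [set y | (rho (y - x)%R < r%:E)%E] `<=` W].
have NF : Filter N.
  split.
  - exists (fun=> 0%E) => //; split; first exact: extended_seminorm_cst0.
    move=> y e e0; apply: (@filterE _ (@nbhs _ (Defs.space tau) y)) => z.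
    by rewrite lte_fin.
  - move=> A B [p [pn pc] pA] [q [qn qc] qB].
    exists (fun y => maxe (p y) (q y)).
      split=> [|y e e0]; first exact: extended_seminorm_max.
      apply: (@filterS _ (@nbhs _ (Defs.space tau) y)) _ _ _ _
        (@filterI _ _ _ _ _ (pc y e e0) (qc y e e0)).
      by move=> z [pz qz] /=; rewrite gt_max pz.
    by move=> y /=; rewrite gt_max => /andP[/pA ? /qB].
  - by move=> A B AB [p pc pA]; exists p => // y /pA/AB.
have [_ Pb] := Pi; move=> /Pb [_ [[D DS <-] Dx] DV].
apply: (@filterS _ N _ _ _ DV); apply: filter_bigI => B DB.
have /set_mem := DS _ DB; have := Dx _ DB.
move=> /[swap] -[rho [z [e [Prho e0 ->]]]] /= xz.
have rn := Pn _ Prho; have [h0 _ hD] := rn.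
have xfin : rho (x - z) \is a fin_num.
  by rewrite ge0_fin_numE // (lt_trans xz) ?ltry.
move: xz; rewrite -(fineK xfin) lte_fin -subr_gt0 => d0.
(* By the triangle inequality, the [rho]-ball of radius [d] about [x] lies in the one of radius [e]
   about [z]; the factor [r / d] turns its radius into [r]. *)
set d := e - _ in d0.
exists (fun y => (r / d)%:E * rho y)%E.
  split=> [|y f f0]; first by apply: extended_seminormZ => //; rewrite divr_gt0.
  have s0 : 0 < (r / d)^-1 * f by rewrite mulr_gt0 // invr_gt0 divr_gt0.
  apply: (@open_nbhs_nbhs (Defs.space tau)); split.
    apply: (subbase_open Pi); exists rho, y, ((r / d)^-1 * f); split=> //.
    by apply/seteqP; split=> w /=; rewrite -lte_pdivlMl ?divr_gt0 // EFinM.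
  by rewrite /= subrr extended_seminorm0 // mule0 lte_fin.
move=> y /=.
rewrite -lte_pdivlMl ?divr_gt0 // -EFinM invf_div mulfVK ?gt_eqF //.
rewrite /d EFinB lteBrDr // fineK // => /(le_lt_trans _); apply.
by rewrite (le_trans _ (hD _ _)) // addrA subrK.
Qed.

End ContinuousSeminorms.

Theorem proposition3p14 (R : realType) (k : scalar_kind)
    (X : lmodType (scalars R k)) (tau tauF : Topological X) (P : X -> R)
    (htau : elcs tau) (htauF : flc_topology tau tauF) (hP : seminorm P) :
  lsc tau P <-> lsc tauF P.
Proof.
split=> /lscP Plsc; apply/lscP => c; last by have [_ + _] := htauF; apply.
rewrite (@openE (Defs.space tauF)) => x0 /=; rewrite in_itv /= andbT => cP.
pose c' := (c + P x0) / 2.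
have cc' : c < c' by rewrite /c'; lra.
have c'P : c' < P x0 by rewrite /c'; lra.
have nP : @nbhs _ (Defs.space tau) x0 (P @^-1` `]c', +oo[).
  apply: (@open_nbhs_nbhs (Defs.space tau)); split=> //=.
  by rewrite in_itv /= c'P.
have P0 x : 0 <= P x by have [/(_ x)] := hP; rewrite lee_fin.
(* The radius [P x0 + 1] is positive and exceeds [c'], whatever the sign of [c']. *)
have r0 : 0 < P x0 + 1 by rewrite ltr_wpDl.
have [rho [rs rc] rV] := elcs_nbhs_seminorm r0 htau nP.
pose q := inf_convolution rho (EFin \o P).
have qs : extended_seminorm q by exact: extended_seminorm_inf_convolution.
have [q0 _ qD] := qs.
have qP x : (q x <= (P x)%:E)%E by exact: inf_convolution_ler.
(* The bound by [P] makes [q] finite, so it comes from a real-valued seminorm, to which the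
   maximality of [tauF] applies. *)
have qE : EFin \o (fine \o q) = q.
  apply/funext => x /=; rewrite fineK // ge0_fin_numE //.
  by rewrite (le_lt_trans (qP x)) ?ltry.
have qtau : continuous_extended_seminorm tau (EFin \o (fine \o q)).
  rewrite qE; split=> // x e /(rc x).
  apply: (@filterS _ (@nbhs _ (Defs.space tau) x)) => y /=; apply: le_lt_trans.
  exact: inf_convolution_lel.
have [_] := flc_continuous_seminorm htauF qtau; rewrite qE => qF.
have qx0 : (c'%:E <= q x0)%E.
  apply: le_inf_convolution => y; have [rho0 _ _] := rs.
  have [ry|ry] := ltP (rho (x0 - y)) (P x0 + 1)%:E.
    have /rV /= : (rho (y - x0)%R < (P x0 + 1)%:E)%E.
      by rewrite -(extended_seminormN _ rs) opprB.
    rewrite in_itv /= andbT => c'y.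
    apply: (@le_trans _ _ (P y)%:E); first by rewrite lee_fin ltW.
    exact: leeDr.
  apply: (@le_trans _ _ (rho (x0 - y))); last by rewrite leeDl ?lee_fin.
  by apply: le_trans ry; rewrite lee_fin; lra.
have e0 : 0 < c' - c by lra.
apply: (@filterS _ (@nbhs _ (Defs.space tauF) x0) _ _ _ _ (qF x0 _ e0)).
move=> y /= qy; rewrite in_itv /= andbT.
(* From [c' <= q x0 <= q (y - x0) + q y] and [q (y - x0) < c' - c] follows [c < q y <= P y]. *)
have := qD (x0 - y) y; rewrite subrK -opprB extended_seminormN //.
move=> /(le_trans qx0).
move: qy (qP y); rewrite -qE /= !lte_fin !lee_fin; lra.
Qed.
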